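(* Assume that either $m$ or $n$ is sufficiently large, $k\ge 3$ and $\mathcal{G},\mathcal{H}\in\mathcal{G}_2$ (that is, $\mathcal{G}$ and $\mathcal{H}$ are good graphs). Then $$R(m\mathcal{C}_r^k,n\mathcal{C}_s^k)=(k-1)rm+(k-1)sn-\min\{m\alpha(\mathcal{C}_r^k),n\alpha(\mathcal{C}_s^k)\}-1,$$ $$R(m\mathcal{P}_r^k,n\mathcal{C}_s^k)=((k-1)r+1)m+(k-1)sn-\min\{m\alpha(\mathcal{P}_r^k),n\alpha(\mathcal{C}_s^k)\}-1,$$ $$R(m\mathcal{P}_r^k,n\mathcal{P}_s^k)=((k-1)r+1)m+((k-1)s+1)n-\min\{m\alpha(\mathcal{P}_r^k),n\alpha(\mathcal{P}_s^k)\}-1,$$ $$R(m\hat{\mathcal{P}}_r^k,n\hat{\mathcal{P}}_s^k)=(r+k-1)m+(s+k-1)n-\min\{m\alpha(\hat{\mathcal{P}}_r^k),n\alpha(\hat{\mathcal{P}}_s^k)\}-1,$$ $$R(m\mathcal{S}_r^k,n\mathcal{S}_s^k)=(k-1)(mr+ns)+m+n-\min\{mr(k-1),ns(k-1)\}-1,$$ $$R(m\mathcal{G},n\mathcal{H})=m|V(\mathcal{G})|+n|V(\mathcal{H})|-\min\{m\alpha(\mathcal{G}),n\alpha(\mathcal{H})\}-1.$$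
   Context: A $k$-uniform hypergraph $\mathcal{H}$ is a pair $(V,E)$ where $V$ is a set of vertices and $E$ is a set of $k$-subsets of $V$ (the edges); graphs are the case $k=2$. $n\mathcal{H}$ denotes $n$ disjoint copies of $\mathcal{H}$. For $k$-uniform $\mathcal{G},\mathcal{H}$, the Ramsey number $R(\mathcal{G},\mathcal{H})$ is the smallest positive integer $N$ such that every red-blue coloring of the edges of the complete $k$-uniform hypergraph on $N$ vertices contains a red copy of $\mathcal{G}$ or a blue copy of $\mathcal{H}$. A set of vertices is independent if it contains no edge; $\alpha(\cdot)$ is the maximum size of an independent set. For a set of indexed vertices, adding $t$ means shifting all subscripts by $t$. Loose cycle $\mathcal{C}_n^k$: vertices $v_1,\dots,v_{n(k-1)}$, edges $e_i=\{v_1,\dots,v_k\}+i(k-1)$, $i=0,\dots,n-1$, subscripts mod $n(k-1)$. Loose path $\mathcal{P}_n^k$: vertices $v_1,\dots,v_{n(k-1)+1}$, edges $e_i=\{v_1,\dots,v_k\}+i(k-1)$, $i=0,\dots,n-1$. Tight path $\hat{\mathcal{P}}_n^k$: vertices $v_1,\dots,v_{n+k-1}$, edges $e_i=\{v_1,\dots,v_k\}+i$, $i=0,\dots,n-1$. Star $\mathcal{S}_n^k$: vertices $v,v_1,\dots,v_{n(k-1)}$, edges $e_i=\{v\}\cup(\{v_1,\dots,v_{k-1}\}+i(k-1))$, $i=0,\dots,n-1$. A strong independent set of a graph is an independent set $S$ of vertices such that every edge has exactly one vertex outside $S$ (such a set exists iff the graph is bipartite); $\alpha^\star(\mathcal{G})$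 is the maximum size of a strong independent set. $\mathcal{G}_2$ is the set of good graphs, i.e. graphs $\mathcal{G}$ that have a strong independent set and satisfy $\alpha^\star(\mathcal{G})=\alpha(\mathcal{G})$.
   Formalization: In the last formula the good graphs G and H are also assumed nonempty with no isolated vertices (it fails for G=K_2+K_1, H=K_2, n=2, m large); loose cycles have at least 2 edges; ''sufficiently large'' may depend on the other multiplicity. *)

(* Defs.v *)
From mathcomp Require Import all_boot.

Set Implicit Arguments.
Unset Strict Implicit.
Unset Printing Implicit Defensive.

Record hypergraph : Type := Hypergraph {
  vert : finType;
  edges : {set {set vert}}
}.

Definition uniform (k : nat) (G : hypergraph) : Prop :=
  forall e : {set vert G}, e \in edges G -> #|e| = k.

Definition complete_hypergraph (k N : nat) : hypergraph :=
  @Hypergraph 'I_N [set e : {set 'I_N} | #|e| == k].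

Definition color_class (G : hypergraph) (c : {set vert G} -> bool) (b : bool) :
    hypergraph :=
  @Hypergraph (vert G) [set e in edges G | c e == b].

Definition contains_copy (F G : hypergraph) : Prop :=
  exists f : vert G -> vert F,
    injective f /\ (forall e : {set vert G}, e \in edges G -> f @: e \in edges F).

(* A coloring is a boolean function on vertex sets, [true] being red and [false]
   blue; its values on non-edges are discarded by [color_class]. *)
Definition arrows (k : nat) (G H : hypergraph) (N : nat) : Prop :=
  forall c : {set 'I_N} -> bool,
    contains_copy (@color_class (complete_hypergraph k N) c true) G \/
    contains_copy (@color_class (complete_hypergraph k N) c false) H.

(* [is_ramsey k G H N] reads R(G, H) = N, for k-uniform G and H. *)
Definition is_ramsey (k : nat) (G H : hypergraph) (N : nat) : Prop :=
  [/\ 0 < N, arrows k G H N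
    & forall N' : nat, 0 < N' -> arrows k G H N' -> N <= N'].

Definition copies (n : nat) (G : hypergraph) : hypergraph :=
  @Hypergraph ('I_n * vert G)%type
    [set [set (i, x) | x in (e : {set vert G})] | i in 'I_n, e in edges G].

Definition independent (G : hypergraph) (S : {set vert G}) : bool :=
  [forall e in edges G, ~~ (e \subset S)].

Definition alpha (G : hypergraph) : nat :=
  \max_(S : {set vert G} | independent S) #|S|.

Definition strong_independent (G : hypergraph) (S : {set vert G}) : bool :=
  independent S && [forall e in edges G, #|e :\: S| == 1].

Definition alpha_star (G : hypergraph) : nat :=
  \max_(S : {set vert G} | strong_independent S) #|S|.

Definition good_graph (G : hypergraph) : Prop :=
  [/\ uniform 2 G, exists S : {set vert G}, strong_independent S
    & alpha_star G = alpha G].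

Definition has_isolated_vertex (G : hypergraph) : Prop :=
  exists v : vert G, forall e : {set vert G}, e \in edges G -> v \notin e.

(* The vertex v_j of the usual notation is the ordinal j - 1.  *)

Definition block (M t k : nat) : {set 'I_M} := [set v : 'I_M | t <= v < t + k].

(* k-uniform when 2 <= k and 2 <= n (and 3 <= k if n = 2, for two distinct edges
   to arise); for n = 1 the two end vertices of the only edge are identified. *)
Definition loose_cycle (k n : nat) : hypergraph :=
  @Hypergraph 'I_(n * (k - 1))
    [set [set v : 'I_(n * (k - 1)) |
           [exists j : 'I_k, v == (j + i * (k - 1)) %% (n * (k - 1)) :> nat]]
    | i : 'I_n].

Definition loose_path (k n : nat) : hypergraph :=
  @Hypergraph 'I_(n * (k - 1) + 1) [set block _ (i * (k - 1)) k | i : 'I_n].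

Definition tight_path (k n : nat) : hypergraph :=
  @Hypergraph 'I_(n + k - 1) [set block _ i k | i : 'I_n].

(* [None] is the centre v. *)
Definition star (k n : nat) : hypergraph :=
  @Hypergraph (option 'I_(n * (k - 1)))
    [set None |: (Some @: block (n * (k - 1)) (i * (k - 1)) (k - 1)) | i : 'I_n].

(* [P m n] holds whenever one of m, n >= 1 is sufficiently large, the bound
   depending on all the other parameters, the other multiplicity included. *)
Definition either_suff_large (P : nat -> nat -> Prop) : Prop :=
  (forall m : nat, 0 < m -> exists n0 : nat, forall n : nat, n0 <= n -> P m n) /\
  (forall n : nat, 0 < n -> exists m0 : nat, forall m : nat, m0 <= m -> P m n).

(* Main.v *)
(** Let [m] be fixed, [n] large, [g = #|V(G)|], [h = #|V(H)|] and
    [M = m (g - alpha G)], so that the claimed value is [n h + M - 1].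

    Upper bound.  Suppose there is no red [mG].  Ramsey's theorem yields a huge
    blue clique [Q]; outside [Q], remove disjoint blue copies of [H] greedily
    until a bounded set [L] is left.  If [M] vertices of [L] each form only red
    edges with the (k-1)-subsets of a common large subset of [Q], they play the
    role of the complement of a strong independent set in [m] red copies of [G].
    Hence, among any [M] vertices of [L], one makes a blue clique with some
    h - 1 vertices of [Q] and is absorbed.  This goes on until at most M - 1
    vertices of [L] remain; tiling the rest of [Q] leaves at most h - 1 more, so
    that the blue copies of [H] cover at least [n h - (h - 1)] vertices, and
    there are [n] of them.

    Lower bound.  Colour blue the edges inside a set of [n h - 1] vertices and
    red all the others.

    The paths, cycles and stars have a set of [c] vertices meeting each of their
    [r] edges exactly once, where [c] is [r] divided by the maximum degree and
    rounded up, so that no smaller set meets all the edges. *)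

Require Import Defs.
From mathcomp Require Import all_boot zify ring.

Set Implicit Arguments.
Unset Strict Implicit.
Unset Printing Implicit Defensive.

(** * Cliques, links and Ramsey's theorem *)

Definition clique (T : finType) (k : nat) (c : {set T} -> bool) (b : bool)
    (A : {set T}) : Prop :=
  forall e : {set T}, e \subset A -> #|e| = k -> c e = b.

Lemma sub_clique (T : finType) k (c : {set T} -> bool) b (A B : {set T}) :
  B \subset A -> clique k c b A -> clique k c b B.
Proof. by move=> sBA cA e sB; apply: cA; apply: subset_trans sBA. Qed.

(** An edge through [x] is decided by the link of [x], any other edge lies in [A]. *)
Lemma clique_setU1 (T : finType) k (c : {set T} -> bool) b (A : {set T}) x :
  clique k.+1 c b A -> clique k (fun e => c (x |: e)) b (A :\ x) ->
  clique k.+1 c b (x |: A).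
Proof.
move=> cA cx e; rewrite -subDset => sA ce; have [xe|xe] := boolP (x \in e).
  rewrite -(setD1K xe); apply: cx; last by move: ce; rewrite (cardsD1 x e) xe; lia.
  by apply/subsetP=> y; rewrite !inE => /andP[yx ye]; rewrite yx (subsetP sA) // !inE yx.
apply: cA => //; apply/subsetP=> y ye; apply: (subsetP sA); rewrite !inE ye andbT.
by apply: contraNneq xe => <-.
Qed.

(** Induction on [k], then on the sum of the two target sizes. The link of a vertex [x] has a large
    clique [B] of some colour [b], by the case of lower uniformity. Inside [B] the target for [b] is
    lowered by one, and [x] makes up for it if the clique found there has colour [b]. *)
Theorem ramsey (k : nat) (s : bool -> nat) :
  exists N, forall (T : finType) (c : {set T} -> bool) (A : {set T}),
    N <= #|A| ->
    exists b (B : {set T}), [/\ B \subset A, s b <= #|B| & clique k c b B].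
Proof.
elim: k s => [|k IHk] s.
  exists (maxn (s true) (s false)) => T c A hA; exists (c set0), A; split=> //.
    by case: (c set0); lia.
  by move=> e _ /eqP; rewrite cards_eq0 => /eqP->.
move: {2}(s true + s false) (leqnn (s true + s false)) => n.
elim: n s => [|n IHn] s hs.
  exists 0 => T c A _; exists true, set0; split; rewrite ?sub0set //; first by lia.
  by move=> e; rewrite subset0 => /eqP->; rewrite cards0.
have [/existsP[b /eqP sb]|/existsPn s_gt0] := boolP [exists b, s b == 0].
  exists 0 => T c A _; exists b, set0; split; rewrite ?sub0set ?sb //.
  by move=> e; rewrite subset0 => /eqP->; rewrite cards0.
pose s' b b' := s b' - (b == b').
have [Nt hNt] : exists N, forall b (T : finType) (c : {set T} -> bool) (A : {set T}),
    N <= #|A| ->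
    exists b' (B : {set T}), [/\ B \subset A, s' b b' <= #|B| & clique k.+1 c b' B].
  have [|N1 h1] := IHn (s' true).
    by have := s_gt0 true; rewrite /s' /=; lia.
  have [|N2 h2] := IHn (s' false).
    by have := s_gt0 false; rewrite /s' /=; lia.
  exists (maxn N1 N2) => -[] T c A hA; [apply: h1|apply: h2]; lia.
(* The colour of the link clique is not known in advance, so both targets are [Nt], which serves
   either colour. *)
have [N hN] := IHk (fun=> Nt).
exists N.+1 => T c A hA; have /card_gt0P[x xA] : 0 < #|A| by lia.
have [|b [B [sB cB hB]]] := hN T (fun e => c (x |: e)) (A :\ x).
  by move: hA; rewrite (cardsD1 x A) xA.
have [b' [B' [sB' cB' hB']]] := hNt b T c B cB.
have sB'A : B' \subset A.
  by apply: subset_trans sB' _; apply: subset_trans sB _; apply: subsetDl.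
have xB' : x \notin B'.
  by apply/negP=> /(subsetP sB')/(subsetP sB); rewrite !inE eqxx.
have [eb|nb] := eqVneq b b'; last first.
  by exists b', B'; split=> //; move: cB'; rewrite /s' (negPf nb) subn0.
exists b', (x |: B'); split.
- by apply/subsetP=> y /setU1P[->|/(subsetP sB'A)].
- by rewrite cardsU1 xB'; move: cB'; rewrite /s' eb eqxx; lia.
apply: clique_setU1 => //; rewrite -eb; apply: sub_clique hB.
by apply: subset_trans (subsetDl _ _) sB'.
Qed.

(** The elements of [W] are treated in turn: either a link contains a blue clique of size [q], or
    [Q] shrinks to a red clique of that link, still large enough for the remaining elements. *)
Lemma ramsey_links (k p q M : nat) :
  exists t, forall (T : finType) (c : {set T} -> bool) (Q : {set T}) (W : seq T),
    size W = M -> t <= #|Q| ->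
    (exists (w : T) (B : {set T}), [/\ w \in W, B \subset Q, q <= #|B|
       & clique k (fun e => c (w |: e)) false B]) \/
    (exists B : {set T}, [/\ B \subset Q, p <= #|B|
       & forall w, w \in W -> clique k (fun e => c (w |: e)) true B]).
Proof.
elim: M => [|M [t IH]].
  by exists p => T c Q [|//] _ hQ; right; exists Q; split.
have [N hN] := ramsey k (fun b => if b then t else q).
exists N => T c Q [//|w W] [sW] hQ.
have [[] [B [sB cB hB]]] := hN T (fun e => c (w |: e)) Q hQ; last first.
  by left; exists w, B; split; rewrite ?mem_head.
have [[v [B' [vW sB' cB' hB']]]|[B' [sB' cB' hB']]] := IH T c B W sW cB.
  by left; exists v, B'; rewrite inE vW orbT (subset_trans sB').
right; exists B'; split; rewrite ?(subset_trans sB') // => v /predU1P[->|/hB'//].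
exact: sub_clique hB.
Qed.

(** * Embeddings and monochromatic copies *)

Lemma exists_embedding (T1 T2 : finType) (A : {set T1}) (B : {set T2}) :
  T2 -> #|A| <= #|B| ->
  exists f : T1 -> T2, {in A &, injective f} /\ {in A, forall x, f x \in B}.
Proof.
move=> t0 leAB; exists (fun x => nth t0 (enum B) (index x (enum A))).
have lt x : x \in A -> index x (enum A) < size (enum B).
  by move=> xA; rewrite -cardE (leq_trans _ leAB) // cardE index_mem mem_enum.
split=> [x y xA yA /eqP|x xA]; last by rewrite -mem_enum mem_nth ?lt.
rewrite nth_uniq ?lt ?enum_uniq // => /eqP exy.
by rewrite -(nth_index x (s := enum A) (x := x)) ?mem_enum // exy nth_index ?mem_enum.
Qed.

Lemma exists_subset_card (T : finType) (A : {set T}) n :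
  n <= #|A| -> exists2 B : {set T}, B \subset A & #|B| = n.
Proof.
move=> len; exists [set x in take n (enum A)].
  by apply/subsetP=> x; rewrite inE => /mem_take; rewrite mem_enum.
by rewrite cardsE (card_uniqP _) ?take_uniq ?enum_uniq // size_takel // -cardE.
Qed.

(** Unlike [contains_copy], this does not ask that images be edges: for a [k]-uniform [F],
    injectivity already gives them [k] elements. *)
Definition mono_copy (T : finType) (c : {set T} -> bool) (b : bool)
    (F : hypergraph) (f : vert F -> T) : Prop :=
  injective f /\ forall e : {set vert F}, e \in edges F -> c (f @: e) = b.

(** The maps form a finite type, so a search settles the alternative constructively. *)
Lemma mono_copy_dec (T : finType) (c : {set T} -> bool) (b : bool)
    (F : hypergraph) :
  (exists f : vert F -> T, mono_copy c b f) \/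
  ~ (exists f : vert F -> T, mono_copy c b f).
Proof.
have [/existsP[f /andP[/injectiveP injf /forall_inP hf]]|/existsPn nf] :=
  boolP [exists f : {ffun vert F -> T},
           injectiveb f && [forall e in edges F, c (f @: e) == b]].
  by left; exists f; split=> // e /hf/eqP.
right=> -[f [injf hf]]; have /negP := nf (finfun f); apply.
apply/andP; split; first by apply/injectiveP=> x y; rewrite !ffunE => /injf.
apply/forall_inP=> e eF; rewrite -(hf e eF); apply/eqP; congr c.
by apply: eq_imset => x; rewrite ffunE.
Qed.

Lemma contains_copyP k N (c : {set 'I_N} -> bool) b (F : hypergraph) :
  uniform k F ->
  contains_copy (@color_class (complete_hypergraph k N) c b) F <->
  exists f : vert F -> 'I_N, mono_copy c b f.
Proof.
move=> uF; split=> -[f [injf hf]]; exists f; split=> // e eF.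
  by have := hf e eF; rewrite inE => /andP[_ /eqP].
by rewrite !inE hf // eqxx andbT card_imset // uF.
Qed.

Lemma clique_copy (T : finType) k (c : {set T} -> bool) b (F : hypergraph)
    (A : {set T}) :
  T -> uniform k F -> clique k c b A -> #|vert F| <= #|A| ->
  exists f : vert F -> T, mono_copy c b f /\ f @: setT \subset A.
Proof.
move=> t0 uF cA leFA; have [|f [injf fA]] := @exists_embedding _ _ [set: vert F] A t0.
  by rewrite cardsT.
have {}injf : injective f by move=> x y; apply: injf; rewrite inE.
have sfA (B : {set vert F}) : f @: B \subset A.
  by apply/subsetP=> _ /imsetP[x _ ->]; apply: fA; rewrite inE.
exists f; split=> //; split=> // e eF; apply: cA => //.
by rewrite card_imset // uF.
Qed.

Lemma copies_edgeP n (F : hypergraph) (e : {set vert (copies n F)}) :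
  reflect (exists (i : 'I_n) (e0 : {set vert F}),
             e0 \in edges F /\ e = [set (i, x) | x in e0])
          (e \in edges (copies n F)).
Proof.
apply: (iffP imset2P) => [[i e0 _ he0 ->]|[i [e0 [he0 ->]]]]; first by exists i, e0.
by exists i e0.
Qed.

Lemma uniform_copies k n F : uniform k F -> uniform k (copies n F).
Proof.
move=> uF e /copies_edgeP[i [e0 [/uF <- ->]]].
by rewrite card_imset // => x y [].
Qed.

Lemma card_copies n F : #|vert (copies n F)| = n * #|vert F|.
Proof. by rewrite /= card_prod card_ord. Qed.

(** * Tilings by vertex-disjoint monochromatic copies *)

(** The set exactly covered is kept as an index, so that uncovered vertices can be counted while
    copies are added one at a time. *)
Inductive tiled (T : finType) (c : {set T} -> bool) (b : bool) (F : hypergraph) :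
    nat -> {set T} -> Prop :=
| tiled0 : tiled c b F 0 set0
| tiledS n (A : {set T}) (f : vert F -> T) :
    mono_copy c b f -> [disjoint f @: setT & A] -> tiled c b F n A ->
    tiled c b F n.+1 (f @: setT :|: A).

Section Tiling.
Variables (T : finType) (c : {set T} -> bool) (b : bool) (F : hypergraph).

Lemma card_tiled n A : tiled c b F n A -> #|A| = n * #|vert F|.
Proof.
elim=> [|{}n {}A f [injf _] dfA _ IH]; first by rewrite cards0.
by rewrite cardsU disjoint_setI0 // cards0 subn0 card_imset // cardsT IH mulSn.
Qed.

Lemma tiledU n1 n2 (A1 A2 : {set T}) :
  tiled c b F n1 A1 -> tiled c b F n2 A2 -> [disjoint A1 & A2] ->
  tiled c b F (n1 + n2) (A1 :|: A2).
Proof.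
move=> t1 t2; elim: t1 => [|{}n1 {}A1 f hf dfA _ IH]; first by rewrite set0U.
rewrite disjoints_subset subUset -!disjoints_subset => /andP[df d1].
rewrite -setUA addSn; constructor=> //; last exact: IH.
by rewrite disjoint_sym disjoints_subset subUset -!disjoints_subset ![[disjoint _ & f @: _]]disjoint_sym dfA.
Qed.

Lemma tiled_maps n A : T -> tiled c b F n A ->
  exists g : nat -> vert F -> T,
    [/\ forall i x, i < n -> g i x \in A,
        forall i j x y, i < n -> j < n -> g i x = g j y -> i = j /\ x = y
      & forall i (e : {set vert F}), i < n -> e \in edges F -> c (g i @: e) = b].
Proof.
move=> t0; elim=> [|{}n {}A f [injf hf] dfA _ [g [gA ginj hg]]].
  by exists (fun _ _ => t0); split.
have fgF i x y : i < n -> f x <> g i y.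
  move=> ltin fg; have := gA i y ltin.
  by rewrite -fg (disjointFr dfA) // imset_f.
(* The new copy receives index [n]; the earlier ones keep theirs. *)
exists (fun i => if i < n then g i else f); split=> [i x|i j x y|i e] lei.
- case: ifP => ltin; rewrite inE; first by rewrite gA ?orbT.
  by rewrite imset_f.
- case: ifP => ltin lej; case: ifP => ltjn.
  + exact: ginj.
  + by move=> /esym/fgF; case.
  + by move=> /fgF; case.
  + by move/injf=> ->; split=> //; lia.
- by case: ifP => ltin; [apply: hg|apply: hf].
Qed.

Lemma tiled_copies m n A : T -> tiled c b F n A -> m <= n ->
  exists f : vert (copies m F) -> T, mono_copy c b f.
Proof.
move=> t0 /(tiled_maps t0)[g [_ ginj hg]] lemn.
have lt (i : 'I_m) : i < n by apply: leq_trans lemn.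
exists (fun p : vert (copies m F) => g p.1 p.2); split=> [[i x] [j y] /= /ginj|e].
  by case=> // [/ord_inj -> ->].
case/copies_edgeP=> i [e0 [he0 ->]]; rewrite -imset_comp.
by rewrite -(hg i e0).
Qed.

End Tiling.

(** * Copies built from links, greedy tiling and absorption *)

Lemma strong_edge (G : hypergraph) (S e : {set vert G}) :
  strong_independent S -> e \in edges G -> #|e :\: S| = 1.
Proof. by case/andP=> _ /forall_inP h /h/eqP. Qed.

(* Copies of [G] are laid out with the complement of [S] in [W] and [S] in [B]. *)
Lemma links_copies (T : finType) k (c : {set T} -> bool) b (G : hypergraph)
    (S : {set vert G}) m (W : seq T) (B : {set T}) :
  T -> uniform k.+1 G -> strong_independent S -> uniq W ->
  m * #|~: S| <= size W -> m * #|S| <= #|B| -> {in B, forall x, x \notin W} ->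
  (forall w, w \in W -> clique k (fun e => c (w |: e)) b B) ->
  exists f : vert (copies m G) -> T, mono_copy c b f.
Proof.
move=> t0 uG sS uW cW cB dWB hW.
have cardX (A : {set vert G}) : #|setX [set: 'I_m] A| = m * #|A|.
  by rewrite cardsX cardsT card_ord.
have [|f1 [inj1 f1W]] := @exists_embedding _ T (setX [set: 'I_m] (~: S)) [set x in W] t0.
  by rewrite cardX [leqRHS]cardsE (card_uniqP uW).
have [|f2 [inj2 f2B]] := @exists_embedding _ T (setX [set: 'I_m] S) B t0.
  by rewrite cardX.
have {}f1W i x : x \notin S -> f1 (i, x) \in W.
  by move=> xS; have := f1W (i, x); rewrite !inE => ->.
have {}f2B i x : x \in S -> f2 (i, x) \in B.
  by move=> xS; apply: f2B; rewrite !inE.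
have f12 i j x y : x \notin S -> y \in S -> f1 (i, x) <> f2 (j, y).
  by move=> xS yS exy; have := dWB _ (f2B j y yS); rewrite -exy f1W.
pose f (p : vert (copies m G)) := if p.2 \in S then f2 p else f1 p.
exists f; split=> [[i x] [j y]|e].
  rewrite /f /=; case: ifPn => xS; case: ifPn => yS.
  - by apply: inj2; rewrite !inE.
  - by move/esym/f12; case.
  - by move/f12; case.
  - by apply: inj1; rewrite !inE.
case/copies_edgeP=> i [e0 [he0 ->]]; rewrite -imset_comp.
(* Only one vertex [x] of the edge lies outside [S], so the image of the edge is a vertex of [W]
   together with [k] vertices of [B], and the link of that vertex gives the colour. *)
have /eqP/cards1P[x ex] := strong_edge sS he0.
have [xe0 xS] : x \in e0 /\ x \notin S.
  by apply/andP; have := set11 x; rewrite -ex inE andbC.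
have finj : {in e0 &, injective (f \o pair i)}.
  move=> y z _ _; rewrite /f /=; case: ifPn => yS; case: ifPn => zS.
  - by move/inj2; rewrite !inE yS zS => /(_ isT isT)[].
  - by move/esym/f12; case.
  - by move/f12; case.
  - by move/inj1; rewrite !inE yS zS => /(_ isT isT)[].
rewrite -(setD1K xe0) imsetU1 /= {1}/f /= (negPf xS).
apply: (hW _ (f1W i x xS)).
  apply/subsetP=> _ /imsetP[y ye ->]; rewrite /f /=.
  suff yS : y \in S by rewrite yS f2B.
  move: ye; rewrite !inE => /andP[yx ye0]; apply/negPn/negP=> yS.
  by move: yx; rewrite -(in_set1 y x) -ex !inE yS ye0.
rewrite card_in_imset; last by move=> y z /setD1P[_ ye] /setD1P[_ ze]; apply: finj.
by have := uG _ he0; rewrite (cardsD1 x) xe0 => -[].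
Qed.

Lemma clique_tiled (T : finType) k (c : {set T} -> bool) b (F : hypergraph)
    (A : {set T}) :
  T -> uniform k F -> 0 < #|vert F| -> clique k c b A ->
  exists n (B : {set T}), [/\ tiled c b F n B, B \subset A & #|A :\: B| < #|vert F|].
Proof.
move=> t0 uF F0 cA; move: {2}#|A| (leqnn #|A|) => N.
elim: N A cA => [|N IH] A cA hA.
  by exists 0, set0; rewrite sub0set setD0; split=> //; [constructor|lia].
have [ltA|leA] := ltnP #|A| #|vert F|.
  by exists 0, set0; rewrite sub0set setD0; split=> //; constructor.
have [f [cf sfA]] := clique_copy t0 uF cA leA.
have cfT : #|f @: setT| = #|vert F| by case: cf => injf _; rewrite card_imset ?cardsT.
have [||n [B [tB sB cB]]] := IH (A :\: f @: setT).
- exact: sub_clique (subsetDl _ _) cA.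
- by rewrite cardsD (setIidPr sfA) cfT; lia.
move: sB; rewrite subsetD => /andP[sBA dB].
exists n.+1, (f @: setT :|: B); split; last by rewrite -setDDl.
  by constructor=> //; rewrite disjoint_sym.
by rewrite subUset sfA.
Qed.

(** Copies are removed until fewer than [C] vertices remain. The slack in [C.+1] settles the empty
    case without knowing that [C] is positive. *)
Lemma greedy_tiled (T : finType) (c : {set T} -> bool) b (F : hypergraph) C
    (U : {set T}) :
  0 < #|vert F| ->
  (forall A : {set T}, C <= #|A| ->
     exists f : vert F -> T, mono_copy c b f /\ f @: setT \subset A) ->
  exists n (B : {set T}), [/\ tiled c b F n B, B \subset U & #|U :\: B| < C.+1].
Proof.
move=> F0 hC; move: {2}#|U| (leqnn #|U|) => N.
elim: N U => [|N IH] U hU.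
  by exists 0, set0; rewrite sub0set setD0; split=> //; [constructor|lia].
have [ltU|leU] := ltnP #|U| C.
  by exists 0, set0; rewrite sub0set setD0; split=> //; [constructor|lia].
have [f [cf sfU]] := hC U leU.
have cfT : #|f @: setT| = #|vert F| by case: cf => injf _; rewrite card_imset ?cardsT.
have [|n [B [tB sB cB]]] := IH (U :\: f @: setT).
  by rewrite cardsD (setIidPr sfU) cfT; lia.
move: sB; rewrite subsetD => /andP[sBU dB].
exists n.+1, (f @: setT :|: B); split; last by rewrite -setDDl.
  by constructor=> //; rewrite disjoint_sym.
by rewrite subUset sfU.
Qed.

(* Absorb the vertices of [L] one by one, each with [#|vert F|.-1] vertices of
   the clique [Q], until fewer than [M] of them are left. *)
Lemma absorb_tiled (T : finType) k (c : {set T} -> bool) b (F : hypergraph) t M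
    (L Q : {set T}) :
  T -> uniform k.+1 F -> 0 < #|vert F| ->
  (forall (W : seq T) (Q' : {set T}), uniq W -> size W = M -> Q' \subset Q ->
     {in Q', forall x, x \notin W} -> t <= #|Q'| ->
     exists w (B : {set T}), [/\ w \in W, B \subset Q', #|vert F| <= #|B|.+1
       & clique k (fun e => c (w |: e)) b B]) ->
  [disjoint L & Q] -> clique k.+1 c b Q -> t + #|vert F| * #|L| <= #|Q| ->
  0 < M ->
  exists n (A : {set T}), [/\ tiled c b F n A, A \subset L :|: Q
    & #|(L :|: Q) :\: A|.+1 < M + #|vert F|].
Proof.
move=> t0 uF F0; move: {2}#|L| (leqnn #|L|) => N.
elim: N L Q => [|N IH] L Q hL hQ dLQ cQ leQ M0.
  have [n [A [tA sA cA]]] := clique_tiled t0 uF F0 cQ.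
  have /eqP-> : L == set0 by rewrite -cards_eq0; lia.
  by exists n, A; rewrite set0U; split=> //; lia.
have [ltL|leL] := ltnP #|L| M.
  (* At most [M - 1] vertices of [L] and [#|vert F| - 1] vertices of [Q] stay uncovered. *)
  have [n [A [tA sA cA]]] := clique_tiled t0 uF F0 cQ.
  exists n, A; split=> //; first by rewrite (subset_trans sA) ?subsetUr.
  rewrite setDUl; have [+ _] := leq_card_setU (L :\: A) (Q :\: A).
  by have := subset_leq_card (subsetDl L A); lia.
have sW : size (take M (enum L)) = M by rewrite size_takel // -cardE.
have WL w : w \in take M (enum L) -> w \in L by move/mem_take; rewrite mem_enum.
have [|||w [B [/WL wL sBQ cB hB]]] := hQ (take M (enum L)) Q _ sW (subxx _).
- by rewrite take_uniq ?enum_uniq.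
- by move=> x xQ; apply/negP=> /WL xL; rewrite (disjointFr dLQ xL) in xQ.
- by lia.
have {cB} [B' sB' cB'] := @exists_subset_card _ B #|vert F|.-1 ltac:(lia).
have {}hB := sub_clique sB' hB; have {sB'} := subset_trans sB' sBQ.
move: {B sBQ} B' cB' hB => B cB hB sBQ.
have wQ : w \notin Q by rewrite (disjointFr dLQ wL).
have wB : w \notin B by apply: contra wQ; apply: (subsetP sBQ).
have cwB : clique k.+1 c b (w |: B).
  apply: clique_setU1; first exact: sub_clique cQ.
  exact: sub_clique (subsetDl _ _) hB.
have cY : #|w |: B| = #|vert F| by rewrite cardsU1 wB; lia.
have [|f [cf sf]] := clique_copy t0 uF cwB; first by rewrite cY.
have cfT : #|f @: setT| = #|vert F| by case: cf => injf _; rewrite card_imset ?cardsT.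
have eY : f @: setT = w |: B by apply/eqP; rewrite eqEcard sf cY cfT leqnn.
have [|||||//|n [A [tA sA cA]]] := IH (L :\ w) (Q :\: B).
- by move: hL; rewrite (cardsD1 w) wL.
- by move=> W Q' uW cW sQ'; apply: hQ; rewrite ?(subset_trans sQ') ?subsetDl.
- rewrite disjoint_sym; apply: disjointWr (subsetDl _ _) _.
  by apply: disjointWl (subsetDl _ _) _; rewrite disjoint_sym.
- exact: sub_clique (subsetDl _ _) cQ.
(* Removing [w] from [L] lowers the required size of [Q] by [#|vert F|], one more than the number of
   vertices of [B] spent. *)
- by rewrite [leqRHS]cardsD (setIidPr sBQ); move: leQ; rewrite (cardsD1 w L) wL mulnDr; lia.
have eLQ : (L :|: Q) :\: (w |: B) = (L :\ w) :|: (Q :\: B).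
  apply/setP=> x; rewrite !inE negb_or; case: (eqVneq x w) => [->|_] /=.
    by rewrite (negPf wQ) andbF.
  case xB: (x \in B) => //=; apply/esym.
  by rewrite orbF (disjointFl dLQ) // (subsetP sBQ).
have : A \subset (L :|: Q) :\: (w |: B) by rewrite eLQ.
rewrite subsetD => /andP[sALQ dA].
exists n.+1, ((w |: B) :|: A); split.
- by rewrite -eY; constructor=> //; rewrite eY disjoint_sym.
- by rewrite 2!subUset sALQ sub1set inE wL (subset_trans sBQ) ?subsetUr.
- by rewrite -setDDl eLQ.
Qed.

(** * The upper and lower bounds for multiple copies *)

Definition spanning (F : hypergraph) : Prop :=
  forall v : vert F, exists2 e : {set vert F}, e \in edges F & v \in e.

(** The equality with [alpha G] makes the bounds meet: the upper one involves the complement of [S],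
    the lower one [#|vert G| - alpha G]. *)
Record well_covered (k : nat) (G : hypergraph) (S : {set vert G}) : Prop :=
  WellCovered {
    well_covered_uniform : uniform k G;
    well_covered_spanning : spanning G;
    well_covered_gt0 : 0 < #|vert G|;
    well_covered_strong : strong_independent S;
    well_covered_alpha : #|S| = alpha G
  }.

Lemma independent_le_alpha (G : hypergraph) (S : {set vert G}) :
  independent S -> #|S| <= alpha G.
Proof. by move=> iS; rewrite /alpha (bigmax_sup S). Qed.

Lemma arrows_copies k (G H : hypergraph) (S : {set vert G}) m :
  1 < k -> uniform k G -> strong_independent S -> uniform k H ->
  0 < #|vert H| -> 0 < m * #|~: S| ->
  exists n0, forall n, n0 <= n ->
    arrows k (copies m G) (copies n H) (n * #|vert H| + m * #|~: S| - 1).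
Proof.
case: k => // k k1 uG sS uH H0 M0; set M := m * #|~: S| in M0 *.
set h := #|vert H| in H0 *; set g := m * #|vert G|.
have [t ht] := ramsey_links k (m * #|S|) h.-1 M.
(* A red clique on [g] vertices would contain the red copies of [G], so any [C] vertices contain a
   blue clique on [h] vertices. The next constant makes the blue clique [Q] big enough to absorb up
   to [C] vertices. *)
have [C hC] := ramsey k.+1 (fun b => if b then g else h).
have [N0 hN0] := ramsey k.+1 (fun b => if b then g else t + h * C).
(* The successor makes ['I_N] inhabited, which supplies the default point [t0]. *)
exists N0.+1 => n len c; set N := n * h + M - 1 in c *.
have leN : N0.+1 <= N by have := leq_pmulr n H0; rewrite /N; lia.
have cT : #|[set: 'I_N]| = N by rewrite cardsT card_ord.
have [[f cf]|noG] := mono_copy_dec c true (copies m G).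
  by left; apply/(contains_copyP _ _ (uniform_copies (n := m) uG)); exists f.
right; apply/(contains_copyP _ _ (uniform_copies (n := n) uH)).
have t0 : 'I_N.
  by apply: (@Ordinal _ 0); apply: leq_trans leN.
have noK (A : {set 'I_N}) : clique k.+1 c true A -> #|A| < g.
  move=> cA; rewrite ltnNge; apply/negP=> leA; apply: noG.
  have [|f [cf _]] := clique_copy t0 (uniform_copies (n := m) uG) cA.
    by rewrite card_copies.
  by exists f.
have [|[] [Q [_ leQ cQ]]] := hN0 _ c [set: 'I_N]; rewrite ?cT //; first exact: ltnW.
  by have := noK Q cQ; rewrite ltnNge leQ.
have [|n1 [A1 [tA1 sA1 cA1]]] := @greedy_tiled _ c false H C (~: Q) H0.
  move=> A /hC-/(_ c)[[] [B [sB leB cB]]]; first by have := noK B cB; rewrite ltnNge leB.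
  have [f [cf sf]] := clique_copy t0 uH cB leB.
  by exists f; split=> //; apply: subset_trans sB.
have dA1Q : [disjoint A1 & Q] by rewrite disjoints_subset.
have [||||//|n2 [A2 [tA2 sA2 cA2]]] :=
  @absorb_tiled _ k c false H t M (~: Q :\: A1) Q t0 uH H0.
- move=> W Q' uW sW sQ' dQW leQ'.
  have [[w [B [wW sB leB hB]]]|[B [sB leB hB]]] := ht _ c Q' W sW leQ'.
    by exists w, B; split=> //; rewrite /h in leB *; lia.
  case: noG; apply: (links_copies t0 uG sS uW _ leB _ hB); first by rewrite sW.
  by move=> x /(subsetP sB)/dQW.
- by rewrite disjoints_subset subsetDl.
- exact: cQ.
- by apply: leq_trans leQ; rewrite leq_add2l leq_mul2l; lia.
have dA : [disjoint A1 & A2].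
  rewrite disjoint_sym; apply: disjointWl sA2 _.
  rewrite disjoints_subset subUset -!disjoints_subset; apply/andP; split.
    by rewrite disjoints_subset; apply/subsetP=> x; rewrite !inE => /andP[].
  by rewrite disjoint_sym.
have tA := tiledU tA1 tA2 dA.
apply: (tiled_copies t0 tA).
(* At most [M + h - 2] of the [n * h + M - 1] vertices are uncovered, so more than [(n - 1) * h] are
   covered, which takes at least [n] tiles. *)
have := card_tiled tA; have := cardsC (A1 :|: A2).
have -> : ~: (A1 :|: A2) = (~: Q :\: A1 :|: Q) :\: A2.
  apply/setP=> x; rewrite !inE negb_or andbC; case: (x \in A2) => //=.
  case xQ: (x \in Q); last by rewrite andbT orbF.
  by rewrite (disjointFl dA1Q xQ).
by rewrite card_ord -/h /N in cA2 * => ??; nia.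
Qed.

(** Blue edges are those inside a set [A] with fewer than [n * #|vert H|] vertices. In a red copy of
    [G] the vertices sent into [A] are independent, so each copy uses at least [#|vert G| - alpha G]
    vertices outside [A]. A blue copy lies inside [A] because [H] is spanning. *)
Lemma arrows_copies_lower k (G H : hypergraph) m n N :
  spanning H -> 0 < n * #|vert H| -> 0 < m * (#|vert G| - alpha G) ->
  arrows k (copies m G) (copies n H) N ->
  n * #|vert H| + m * (#|vert G| - alpha G) - 1 <= N.
Proof.
set M := m * _; set h := n * _ => sH h0 M0 arr; rewrite leqNgt; apply/negP=> ltN.
(* The minimum covers the case where [N] itself is smaller than [h.-1]. *)
have [|A _ cA] := @exists_subset_card _ [set: 'I_N] (minn h.-1 N).
  by rewrite cardsT card_ord geq_minr.
have cB : #|~: A| < M.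
  by have := cardsC A; rewrite card_ord cA => ?; rewrite /M /h in ltN h0 M0 cA *; lia.
have {}cA : #|A| < h by rewrite cA gtn_min prednK ?leqnn.
have [[f [injf hf]]|[f [injf hf]]] := arr (fun e => ~~ (e \subset A)).
  pose B i := [set x : vert G | f (i, x) \notin A].
  have leB i : #|vert G| - alpha G <= #|B i|.
    have iB : independent (~: B i).
      apply/forall_inP=> e eG; apply/negP=> /subsetP seB.
      have : [set (i, x) | x in e] \in edges (copies m G).
        by apply/copies_edgeP; exists i, e.
      move=> /hf; rewrite !inE eqb_id => /andP[_ /negP]; apply.
      apply/subsetP=> _ /imsetP[_ /imsetP[x xe ->] ->].
      by have := seB x xe; rewrite !inE negbK.
    by have := independent_le_alpha iB; have := cardsC (B i); lia.
  suff leM : M <= #|~: A| by move: cB; rewrite ltnNge leM.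
  have le : #|f @^-1: (~: A)| <= #|~: A|.
    rewrite -(card_imset _ injf); apply: subset_leq_card.
    by apply/subsetP=> _ /imsetP[x + ->]; rewrite inE.
  apply: leq_trans le.
  have -> : f @^-1: (~: A) = [set p | p.2 \in B p.1].
    by apply/setP=> -[i x]; rewrite !inE.
  rewrite -sum1dep_card -(pair_big_dep xpredT (fun i x => x \in B i) (fun _ _ => 1)).
  rewrite /M -[X in X * _]card_ord -sum_nat_const leq_sum // => i _.
  by rewrite sum1_card.
suff leH : h <= #|A| by move: cA; rewrite ltnNge leH.
rewrite /h -card_copies -cardsT -(card_imset _ injf); apply: subset_leq_card.
apply/subsetP=> _ /imsetP[[i x] _ ->].
have [e eH xe] := sH x.
have : [set (i, y) | y in e] \in edges (copies n H) by apply/copies_edgeP; exists i, e.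
move=> /hf; rewrite !inE => /andP[_]; rewrite eqbF_neg negbK => /subsetP; apply.
by apply/imset_f/imset_f.
Qed.

(** Negating the colouring exchanges the two hypergraphs. *)
Lemma is_ramsey_sym k (G H : hypergraph) N :
  is_ramsey k G H N -> is_ramsey k H G N.
Proof.
have arrS G1 G2 N' : arrows k G1 G2 N' -> arrows k G2 G1 N'.
  move=> arr c; have swap F b :
      contains_copy (@color_class (complete_hypergraph k N') (fun e => ~~ c e) b) F ->
      contains_copy (@color_class (complete_hypergraph k N') c (~~ b)) F.
    move=> [f [injf hf]]; exists f; split=> // e /hf.
    by rewrite !inE => /andP[-> /eqP <-]; rewrite negbK eqxx.
  by case: (arr (fun e => ~~ c e)) => /swap; [right|left].
by case=> N0 /arrS arr le; split=> // N' N'0 /arrS; apply: le.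
Qed.

Lemma strong_alpha_ltn k (G : hypergraph) (S : {set vert G}) :
  well_covered k S -> alpha G < #|vert G|.
Proof.
case=> _ spG /card_gt0P[v _] /andP[/forall_inP iS _] <-.
have [e eG ve] := spG v; rewrite ltn_neqAle max_card andbT.
apply: contra (iS e eG) => cS; suff -> : S = setT by apply: subsetT.
by apply/eqP; rewrite eqEcard subsetT cardsT (eqP cS) leqnn.
Qed.

Lemma alpha_gt0 k (G : hypergraph) : 1 < k -> uniform k G -> 0 < #|vert G| ->
  0 < alpha G.
Proof.
move=> k1 uG /card_gt0P[v _]; rewrite -(cards1 v); apply: independent_le_alpha.
apply/forall_inP=> e eG; apply/negP=> /subset_leq_card.
by rewrite cards1 (uG e eG); lia.
Qed.

Lemma ramsey_copies_large k (G H : hypergraph) (S : {set vert G})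
    (S' : {set vert H}) m :
  1 < k -> well_covered k S -> well_covered k S' -> 0 < m ->
  exists n0, forall n, n0 <= n ->
    is_ramsey k (copies m G) (copies n H)
      (m * #|vert G| + n * #|vert H| - minn (m * alpha G) (n * alpha H) - 1).
Proof.
move=> k1 wG wH m0; have lt := strong_alpha_ltn wG.
have [uG _ G0 sS eS] := wG; have [uH spH H0 _ _] := wH.
have a0 := alpha_gt0 k1 uH H0.
have cS : #|~: S| = #|vert G| - alpha G by have := cardsC S; lia.
have M0 : 0 < m * (#|vert G| - alpha G) by rewrite muln_gt0 m0; lia.
have [|n0 hn0] := @arrows_copies k G H S m k1 uG sS uH H0; first by rewrite cS.
(* Since [alpha H] is positive, such an [n] makes [m * alpha G] the minimum; the successor keeps [n]
   positive. *)
exists (maxn n0 (m * alpha G).+1) => n; rewrite geq_max => /andP[/hn0 arr len].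
have le1 : m * alpha G <= n * alpha H by have := leq_pmulr n a0; lia.
have le2 : 0 < n * #|vert H| by rewrite muln_gt0 H0 andbT; lia.
have le3 : m * alpha G <= m * #|vert G| by rewrite leq_mul2l (ltnW lt) orbT.
have eN : m * #|vert G| + n * #|vert H| - minn (m * alpha G) (n * alpha H) - 1
    = n * #|vert H| + m * (#|vert G| - alpha G) - 1.
  by rewrite (minn_idPl le1) mulnBr; lia.
rewrite eN; split.
- by lia.
- by rewrite -cS.
- by move=> N' _; apply: arrows_copies_lower.
Qed.

Lemma either_suff_large_ramsey k (G H : hypergraph) (S : {set vert G})
    (S' : {set vert H}) :
  1 < k -> well_covered k S -> well_covered k S' ->
  either_suff_large (fun m n => is_ramsey k (copies m G) (copies n H)
    (m * #|vert G| + n * #|vert H| - minn (m * alpha G) (n * alpha H) - 1)).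
Proof.
move=> k1 wG wH; split=> [m m0|n n0]; first exact: ramsey_copies_large k1 wG wH m0.
have [m1 hm1] := ramsey_copies_large k1 wH wG n0.
exists m1 => m /hm1/is_ramsey_sym.
by rewrite minnC [n * _ + _]addnC.
Qed.

(** * Well covered hypergraphs: good graphs, paths, stars and cycles *)

(** A strong independent set of maximum size has [alpha G] vertices by goodness, and the absence of
    isolated vertices is the spanning condition. *)
Lemma good_graph_well_covered (G : hypergraph) :
  good_graph G -> 0 < #|vert G| -> ~ has_isolated_vertex G ->
  exists S : {set vert G}, well_covered 2 S.
Proof.
case=> uG [S0 sS0] eG G0 niG.
have [S sS eS] : {S : {set vert G} | strong_independent S & alpha_star G = #|S|}.
  have [|S sS eS] := @eq_bigmax_cond _ (@strong_independent G) (fun S => #|S|).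
    by apply/card_gt0P; exists S0.
  by exists S.
exists S; split=> // [v|]; last by rewrite -eG.
have [/exists_inP[e]|/exists_inPn ni] := boolP [exists e in edges G, v \in e].
  by exists e.
by case: niG; exists v.
Qed.

(* The vertices [x j] hit each edge exactly once; as a vertex hits at most [d] of
   the [r] edges, no fewer than [r / d] vertices hit them all. *)
Lemma well_covered_transversal k (G : hypergraph) r d c (e : 'I_r -> {set vert G})
    (x : 'I_c -> vert G) :
  0 < #|vert G| -> spanning G -> uniform k G ->
  edges G = [set e i | i : 'I_r] -> 0 < d -> r <= c * d < r + d ->
  (forall j i, (x j \in e i) = (j == i %/ d :> nat)) ->
  (forall v, #|[set i | v \in e i]| <= d) ->
  well_covered k (~: [set x j | j : 'I_c]) /\ alpha G = #|vert G| - c.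
Proof.
move=> G0 spG uG eE d0 /andP[lerc ltcr] xe deg.
have hit i : exists j : 'I_c, [set x j | j : 'I_c] :&: e i = [set x j].
  have lt : i %/ d < c by rewrite ltn_divLR // (leq_trans (ltn_ord i)).
  exists (Ordinal lt); apply/setP=> v; rewrite !inE; apply/andP/eqP=> [[]|->].
    by move=> /imsetP[j _ ->]; rewrite xe => /eqP ej; congr x; apply: val_inj.
  by rewrite imset_f // xe /=.
have xinj : injective x.
  (* The edge with index [j1 * d] exists and contains [x j1] but no [x j] with another index. *)
  move=> j1 j2 ej; have lt : j1 * d < r.
    have : j1.+1 * d <= c * d by rewrite leq_pmul2r.
    by rewrite mulSn; lia.
  have := xe j1 (Ordinal lt); rewrite ej xe /= mulnK // eqxx => /eqP ej2.
  by apply/esym/val_inj.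
set X := [set x j | j : 'I_c] in hit *.
have cX : #|X| = c by rewrite card_imset // cardT size_enum_ord.
have maxS (S : {set vert G}) : independent S -> c <= #|~: S|.
  (* Double counting: each of the [r] edges meets the complement of [S], and each vertex lies on at
     most [d] of them. *)
  move=> /forall_inP iS; suff : r <= #|~: S| * d by nia.
  apply: (@leq_trans (\sum_(i < r) 1)); first by rewrite sum1_card card_ord.
  have hitS i : 1 <= \sum_(v in ~: S) (v \in e i).
    have : e i \in edges G by rewrite eE imset_f.
    move=> /iS/subsetPn[v ve vS].
    by rewrite (bigD1 v) ?inE //= ve.
  apply: (@leq_trans (\sum_(i < r) \sum_(v in ~: S) (v \in e i))).
    exact: leq_sum.
  rewrite exchange_big /= -sum_nat_const leq_sum // => v _.
  apply: leq_trans (deg v); rewrite -sum1dep_card [leqRHS]big_mkcond /=.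
  by apply: leq_sum => i _; case: (v \in e i).
have iX : independent (~: X).
  apply/forall_inP=> _ /[!eE] /imsetP[i _ ->]; have [j hj] := hit i.
  apply/subsetPn; exists (x j).
    by have := set11 (x j); rewrite -hj inE => /andP[].
  by rewrite inE negbK imset_f.
have aX : alpha G = #|~: X|.
  apply/eqP; rewrite eqn_leq independent_le_alpha // andbT.
  apply/bigmax_leqP => S iS; have := maxS S iS.
  by have := cardsC S; have := cardsC X; lia.
split; last by rewrite aX -cX; have := cardsC X; lia.
split=> //; rewrite /strong_independent iX /=.
apply/forall_inP=> _ /[!eE] /imsetP[i _ ->]; have [j hj] := hit i.
by rewrite setDE setCK setIC hj cards1.
Qed.

Lemma card_ord_seq n (A : {set 'I_n}) (l : seq nat) :
  (forall i : 'I_n, i \in A -> val i \in l) -> #|A| <= size l.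
Proof.
move=> sAl; rewrite cardE -(size_map val); apply: uniq_leq_size.
  by rewrite map_inj_uniq ?enum_uniq //; apply: val_inj.
by move=> _ /mapP[i + ->]; rewrite mem_enum; apply: sAl.
Qed.

Lemma card_block M t k : t + k <= M -> #|block M t k| = k.
Proof.
move=> le; rewrite -[RHS]card_ord.
have lt (i : 'I_k) : t + i < M by have := ltn_ord i; lia.
rewrite -(card_imset _ (f := fun i => Ordinal (lt i))); last first.
  by move=> i j /(congr1 val)/= /addnI/val_inj.
apply: eq_card => v; rewrite !inE; apply/idP/imsetP => [hv|[i _ ->]] /=.
  have ltk : v - t < k by lia.
  by exists (Ordinal ltk) => //; apply: val_inj => /=; lia.
by have := ltn_ord i; lia.
Qed.

Lemma loose_path_well_covered k r : 3 <= k -> 1 <= r ->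
  exists S : {set vert (loose_path k r)}, well_covered k S.
Proof.
(* The chosen vertices are those shared by edges [2 * j] and [2 * j + 1]; for odd [r] the last one
   is the end of the path. *)
move=> k3 r1; have ltx (j : 'I_(uphalf r)) : (2 * j + 1) * (k - 1) < r * (k - 1) + 1.
  by have ltj := ltn_ord j; rewrite [ltnRHS]addn1 ltnS leq_mul2r; lia.
have [||||||||wS _] := @well_covered_transversal k (loose_path k r) r 2 (uphalf r)
   (fun i => block _ (i * (k - 1)) k) (fun j => Ordinal (ltx j)); last by eexists; apply: wS.
- by rewrite card_ord addn1.
- move=> v; have ltv := ltn_ord v.
  (* The final vertex has quotient [r], hence the cap at [r.-1]. *)
  have lti : minn (v %/ (k - 1)) r.-1 < r by lia.
  exists (block _ (Ordinal lti * (k - 1)) k); first by rewrite imset_f.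
  have := divn_eq v (k - 1); have := @ltn_pmod v (k - 1) ltac:(lia).
  by rewrite inE /=; nia.
- move=> _ /imsetP[i _ ->]; apply: card_block.
  by have := ltn_ord i; nia.
- by [].
- by [].
- by lia.
- by move=> j i; rewrite inE /=; have ltj := ltn_ord j; apply/idP/eqP; nia.
- move=> v; apply: (@card_ord_seq _ _ [:: v %/ (k - 1); (v %/ (k - 1)).-1]) => i.
  rewrite !inE => /andP[le lt].
  have le1 : i <= v %/ (k - 1) by rewrite leq_divRL //; lia.
  have : v %/ (k - 1) < i.+2 by rewrite ltn_divLR ?mulSn; lia.
  by move: le1; case: (v %/ (k - 1)) => [|q] /=; lia.
Qed.

Lemma tight_path_well_covered k r : 3 <= k -> 1 <= r ->
  exists S : {set vert (tight_path k r)}, well_covered k S.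
Proof.
(* Here [c] is [r / k] rounded up. The vertex [j * k + k.-1] lies exactly on the edges from [j * k]
   to [j * k + k.-1] that exist. *)
move=> k3 r1; pose c := (r.-1 %/ k).+1.
have [hc1 hc2] : r <= c * k /\ c * k < r + k.
  have := divn_eq r.-1 k; have := @ltn_pmod r.-1 k ltac:(lia).
  by rewrite /c mulSn; lia.
have ltx (j : 'I_c) : j * k + k.-1 < r + k - 1.
  have : j.+1 * k <= c * k by rewrite leq_mul2r ltn_ord orbT.
  by rewrite mulSn; lia.
have [||||||||wS _] := @well_covered_transversal k (tight_path k r) r k c
   (fun i => block _ i k) (fun j => Ordinal (ltx j)); last by eexists; apply: wS.
- by rewrite card_ord; lia.
- move=> v; have ltv := ltn_ord v.
  have lti : minn v r.-1 < r by lia.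
  exists (block _ (Ordinal lti) k); first by rewrite imset_f.
  by rewrite inE /=; lia.
- move=> _ /imsetP[i _ ->]; apply: card_block.
  by have := ltn_ord i; lia.
- by [].
- by lia.
- by rewrite hc1.
- move=> j i; rewrite inE /=.
  rewrite eqn_leq leq_divRL -?[_ %/ k <= j]ltnS ?ltn_divLR ?mulSn; lia.
- move=> v; rewrite -[leqRHS](size_iota (v + 1 - k)); apply: card_ord_seq => i.
  by rewrite !inE mem_iota /=; lia.
Qed.

(** The centre alone meets every edge, so [d = r] and [c = 1]. The value of [alpha] is recorded
    because the formula for stars uses it explicitly. *)
Lemma star_well_covered k r : 3 <= k -> 1 <= r ->
  exists S : {set vert (star k r)},
    well_covered k S /\ alpha (star k r) = r * (k - 1).
Proof.
move=> k3 r1.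
have [||||||||wS eS] := @well_covered_transversal k (star k r) r r 1
   (fun i => None |: (Some @: block (r * (k - 1)) (i * (k - 1)) (k - 1)))
   (fun=> None); last by eexists; split; [apply: wS|rewrite eS card_option card_ord subn1].
- by rewrite card_option.
- case=> [v|]; last first.
    exists (None |: (Some @: block (r * (k - 1)) (Ordinal r1 * (k - 1)) (k - 1))).
      by apply/imsetP; exists (Ordinal r1).
    by rewrite !inE.
  have lti : v %/ (k - 1) < r by rewrite ltn_divLR //; lia.
  exists (None |: (Some @: block (r * (k - 1)) (Ordinal lti * (k - 1)) (k - 1))).
    by apply/imsetP; exists (Ordinal lti).
  rewrite !inE imset_f //= inE /=.
  have := divn_eq v (k - 1); have := @ltn_pmod v (k - 1) ltac:(lia); lia.
- move=> _ /imsetP[i _ ->]; rewrite cardsU1 card_imset; last by move=> ? ? [].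
  rewrite card_block; last by have := ltn_ord i; nia.
  by case: imsetP => [[] //|_]; lia.
- by [].
- by [].
- by lia.
- by move=> j i; rewrite !inE divn_small // ord1.
- by move=> v; rewrite (leq_trans (max_card _)) ?card_ord.
Qed.

Definition cycle_edge k r (i : nat) : {set 'I_(r * (k - 1))} :=
  [set v : 'I_(r * (k - 1)) |
     [exists j : 'I_k, v == (j + i * (k - 1)) %% (r * (k - 1)) :> nat]].

(** Only the last vertex of an edge, [j = k - 1], can wrap around, and it starts the next block; the
    others form the block with quotient [i]. *)
Lemma mem_cycle_edge k r (i : 'I_r) (v : 'I_(r * (k - 1))) :
  1 < k -> (v \in cycle_edge k r i)
           = (v %/ (k - 1) == i) || (v == (i.+1 %% r) * (k - 1) :> nat).
Proof.
move=> k1; rewrite inE; set p := k - 1; have p0 : 0 < p by rewrite /p; lia.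
have lti := ltn_ord i.
have small j : j < p -> (j + i * p) %% (r * p) = j + i * p.
  by move=> ltj; rewrite modn_small; nia.
have wrap : (p + i * p) %% (r * p) = i.+1 %% r * p by rewrite -mulSn muln_modl.
have ltv : v < r * p := ltn_ord v.
apply/existsP/orP => [[j /eqP ->]|[/eqP ev|/eqP ev]].
- have [ltj|gej] := ltnP j p.
    by left; rewrite small // addnC divnMDl // divn_small ?addn0.
  have -> : nat_of_ord j = p by have := ltn_ord j; rewrite /p in gej *; lia.
  by right; rewrite wrap.
- have ltk : v %% p < k by have := @ltn_pmod v p p0; rewrite /p; lia.
  exists (Ordinal ltk); rewrite /= -ev addnC -divn_eq modn_small //.
- have ltk : p < k by rewrite /p; lia.
  by exists (Ordinal ltk); rewrite /= wrap ev.
Qed.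

Lemma loose_cycle_well_covered k r : 3 <= k -> 2 <= r ->
  exists S : {set vert (loose_cycle k r)}, well_covered k S.
Proof.
move=> k3 r2; have p1 : 1 < k - 1 by lia.
have p0 : 0 < k - 1 := ltnW p1.
(* As for paths, shared vertices cover the edges in pairs. For odd [r] the last edge is left alone
   and gets an interior vertex, since its shared vertices also lie on other edges. *)
have ltx (j : 'I_(uphalf r)) :
    (if 2 * j + 1 < r then (2 * j + 1) * (k - 1) else 2 * j * (k - 1) + 1) < r * (k - 1).
  have := ltn_ord j; case: ifP => hj ltj; first by rewrite ltn_pmul2r.
  have : (2 * j).+1 * (k - 1) <= r * (k - 1) by rewrite leq_pmul2r //; lia.
  by rewrite mulSn; lia.
have [||||||||wS _] := @well_covered_transversal k (loose_cycle k r) r 2 (uphalf r)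
   (fun i => cycle_edge k r i) (fun j => Ordinal (ltx j)); last by eexists; apply: wS.
- by rewrite card_ord muln_gt0 p0 andbT; lia.
- move=> v; have lti : v %/ (k - 1) < r by rewrite ltn_divLR // ltn_ord.
  exists (cycle_edge k r (Ordinal lti)); first by apply/imsetP; exists (Ordinal lti).
  by rewrite mem_cycle_edge ?eqxx //; lia.
- move=> _ /imsetP[i _ ->]; suff : #|cycle_edge k r i| = k by [].
  have lt : i.+1 %% r * (k - 1) < r * (k - 1) by rewrite ltn_pmul2r // ltn_mod; lia.
  have -> : cycle_edge k r i = Ordinal lt |: block (r * (k - 1)) (i * (k - 1)) (k - 1).
    apply/setP=> v; rewrite mem_cycle_edge ?inE; last by lia.
    rewrite orbC; congr orb.
    by rewrite eqn_leq leq_divRL // -?[_ %/ _ <= _]ltnS ltn_divLR // mulSn; lia.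
  rewrite cardsU1 card_block; last by rewrite addnC -mulSn leq_pmul2r // ltn_ord.
  (* With [r >= 2] the next block differs from block [i], so the wrapped vertex is a new one. *)
  rewrite inE /=; have ne : i.+1 %% r != i.
    have := ltn_ord i; rewrite leq_eqVlt => /predU1P[e|lti]; last by rewrite modn_small //; lia.
    by rewrite e modnn; lia.
  case: andP => [[le1 le2]|_]; last by lia.
  case/eqP: ne; move: le1 le2; rewrite leq_pmul2r // [_ * _ + _]addnC -mulSn ltn_pmul2r //.
  by lia.
- by [].
- by [].
- by lia.
- move=> j i; rewrite mem_cycle_edge /=; last by lia.
  have := ltn_ord j; have := ltn_ord i; case: ifP => hj lti ltj.
    rewrite mulnK // eqn_pmul2r //.
    move: (lti); rewrite leq_eqVlt => /predU1P[e|lti1]; last by rewrite modn_small //; lia.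
    by rewrite e modnn; lia.
  rewrite divnMDl // divn_small // addn0.
  (* The interior vertex has remainder 1 modulo [k - 1 > 1], so it does not start a block. *)
  have -> : (2 * j * (k - 1) + 1 == i.+1 %% r * (k - 1)) = false.
    by apply/eqP=> /(congr1 (modn^~ (k - 1))); rewrite modnMDl modnMl modn_small.
  by lia.
- move=> v; set q := v %/ (k - 1).
  (* A vertex lies on the edge of its own block and possibly on the cyclically preceding edge. *)
  apply: (@card_ord_seq _ _ [:: q; if q == 0 then r.-1 else q.-1]) => i.
  rewrite inE mem_cycle_edge -/q; last by lia.
  rewrite !inE /= => /orP[/eqP->|/eqP ev]; first by rewrite eqxx.
  apply/orP; right; rewrite /q ev mulnK //.
  have := ltn_ord i; rewrite leq_eqVlt => /predU1P[e|lti]; last by rewrite modn_small.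
  by rewrite e modnn /=; lia.
Qed.

(** * Assembly of the six formulas *)

Lemma either_suff_large_mono (P Q : nat -> nat -> Prop) :
  (forall m n, P m n -> Q m n) -> either_suff_large P -> either_suff_large Q.
Proof.
move=> PQ [h1 h2]; split=> [m /h1[n0 h]|n /h2[m0 h]].
  by exists n0 => n /h; apply: PQ.
by exists m0 => m /h; apply: PQ.
Qed.

(* The natural-number subtractions never truncate: each minimum is at most m
   times the number of vertices of the first hypergraph. *)
Theorem theorem2p9 (k r s : nat) (G H : hypergraph)
  (hk : 3 <= k) (hr : 1 <= r) (hs : 1 <= s)
  (hG : good_graph G) (hH : good_graph H)
  (hG0 : 0 < #|vert G|) (hH0 : 0 < #|vert H|)
  (hGi : ~ has_isolated_vertex G) (hHi : ~ has_isolated_vertex H) :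
  (2 <= r -> 2 <= s ->
   either_suff_large (fun m n =>
     is_ramsey k (copies m (loose_cycle k r)) (copies n (loose_cycle k s))
       ((k - 1) * r * m + (k - 1) * s * n
        - minn (m * alpha (loose_cycle k r)) (n * alpha (loose_cycle k s)) - 1)))
  /\
  (2 <= s ->
   either_suff_large (fun m n =>
     is_ramsey k (copies m (loose_path k r)) (copies n (loose_cycle k s))
       (((k - 1) * r + 1) * m + (k - 1) * s * n
        - minn (m * alpha (loose_path k r)) (n * alpha (loose_cycle k s)) - 1)))
  /\
  either_suff_large (fun m n =>
    is_ramsey k (copies m (loose_path k r)) (copies n (loose_path k s))
      (((k - 1) * r + 1) * m + ((k - 1) * s + 1) * n
       - minn (m * alpha (loose_path k r)) (n * alpha (loose_path k s)) - 1))
  /\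
  either_suff_large (fun m n =>
    is_ramsey k (copies m (tight_path k r)) (copies n (tight_path k s))
      ((r + k - 1) * m + (s + k - 1) * n
       - minn (m * alpha (tight_path k r)) (n * alpha (tight_path k s)) - 1))
  /\
  either_suff_large (fun m n =>
    is_ramsey k (copies m (star k r)) (copies n (star k s))
      ((k - 1) * (m * r + n * s) + m + n
       - minn (m * r * (k - 1)) (n * s * (k - 1)) - 1))
  /\
  either_suff_large (fun m n =>
    is_ramsey 2 (copies m G) (copies n H)
      (m * #|vert G| + n * #|vert H| - minn (m * alpha G) (n * alpha H) - 1)).
Proof.
Proof.
have k1 : 1 < k by lia.
(* The function [N] stands for the form in which each formula is stated, leaving an arithmetic
   identity in each case. *)
have ramsey_copies (G1 G2 : hypergraph) (N : nat -> nat -> nat) k' : 1 < k' ->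
    (exists S : {set vert G1}, well_covered k' S) ->
    (exists S : {set vert G2}, well_covered k' S) ->
    (forall m n, m * #|vert G1| + n * #|vert G2|
                 - minn (m * alpha G1) (n * alpha G2) - 1 = N m n) ->
    either_suff_large (fun m n => is_ramsey k' (copies m G1) (copies n G2) (N m n)).
  move=> k'1 [S1 w1] [S2 w2] eN.
  apply: either_suff_large_mono (either_suff_large_ramsey k'1 w1 w2) => m n.
  by rewrite eN.
have cC t : #|vert (loose_cycle k t)| = t * (k - 1) by rewrite card_ord.
have cP t : #|vert (loose_path k t)| = t * (k - 1) + 1 by rewrite card_ord.
have cT t : #|vert (tight_path k t)| = t + k - 1 by rewrite card_ord.
have cS t : #|vert (star k t)| = t * (k - 1) + 1.
  by rewrite card_option card_ord addn1.
split; last split; last split; last split; last split.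
- move=> r2 s2; apply: ramsey_copies => // [||m n]; try exact: loose_cycle_well_covered.
  by rewrite !cC; congr (_ - _ - _); ring.
- move=> s2; apply: ramsey_copies => // [||m n]; first exact: loose_path_well_covered.
    exact: loose_cycle_well_covered.
  by rewrite cP cC; congr (_ - _ - _); ring.
- apply: ramsey_copies => // [||m n]; try exact: loose_path_well_covered.
  by rewrite !cP; congr (_ - _ - _); ring.
- apply: ramsey_copies => // [||m n]; try exact: tight_path_well_covered.
  by rewrite !cT; congr (_ - _ - _); ring.
- have [S1 [w1 a1]] := star_well_covered hk hr.
  have [S2 [w2 a2]] := star_well_covered hk hs.
  apply: ramsey_copies => // [||m n]; [by exists S1|by exists S2|].
  by rewrite !cS a1 a2 !mulnA; congr (_ - _ - _); ring.
- by apply: ramsey_copies => //; apply: good_graph_well_covered.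
Qed.
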